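(* Let $\Gamma=(X,R)$ be a bipartite distance-regular graph with even diameter $D\ge4$ and valency $k\ge3$, let $d=D/2$, fix $x\in X$, let $W$ be a thin irreducible $T(x)$-module with endpoint $2$ and local eigenvalue $\tilde\theta_d$, and let $v$ be a nonzero vector in $E^*_2W$. Then the vectors $E^*_{i+2}A_iv$ $(0\le i\le D-3)$ form a basis for $W$.
   Context: $\Gamma$ is a finite connected bipartite distance-regular graph with distance $\partial$, intersection numbers $c_i,b_i$; $A_i$ are the distance matrices, $A=A_1$, with eigenvalues $\theta_0>\theta_1>\dots>\theta_D$. $E^*_i$ is the diagonal matrix with $(y,y)$-entry $1$ if $\partial(x,y)=i$, else $0$; $T(x)$ is the algebra generated by $A,E^*_0,\dots,E^*_D$. $T$-modules are $T$-invariant subspaces of $\mathbb{C}^X$; thin means $\dim E^*_iW\le1$ for all $i$; endpoint is $\min\{i:E^*_iW\ne0\}$; the local eigenvalue of a thin irreducible $W$ with endpoint $2$ is the eigenvalue of $E^*_2A_2E^*_2$ on the one-dimensional space $E^*_2W$. $\tilde\theta_d=-1-b_2b_3(\theta_d^2-b_2)^{-1}$. *)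

(* Defs.v *)
From HB Require Import structures.
From mathcomp Require Import all_boot all_order all_algebra.
From mathcomp Require Import reals.
From mathcomp Require Import complex.

Set Implicit Arguments.
Unset Strict Implicit.
Unset Printing Implicit Defensive.

Import Order.TTheory GRing.Theory Num.Theory.
Local Open Scope ring_scope.

Section Graph.
Variables (X : finType) (e : rel X).

Definition simple_graph : Prop := symmetric e /\ irreflexive e.

Definition connected_graph : Prop := forall y z : X, connect e y z.

Definition bipartite : Prop :=
  exists f : X -> bool, forall y z : X, e y z -> f y != f z.

Definition regular_of_valency (k : nat) : Prop :=
  forall y : X, #|[set z | e y z]| = k.

Definition walk (n : nat) (y z : X) : bool :=
  [exists p : n.-tuple X, path e y p && (last y p == z)].

(* Least length of a walk from y to z.  If there is no walk the value is #|X|,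
   which is never the distance between two connected vertices. *)
Definition dist (y z : X) : nat := find (fun n => walk n y z) (iota 0 #|X|).

Definition diameter : nat := (\max_(y : X) \max_(z : X) dist y z)%N.

(* p h i j is the intersection number p^h_{ij}; its values for h greater than
   the diameter are irrelevant. *)
Definition distance_regular (p : nat -> nat -> nat -> nat) : Prop :=
  forall (i j : nat) (y z : X),
    #|[set w | (dist y w == i) && (dist z w == j)]| = p (dist y z) i j.

End Graph.

Definition b_ (p : nat -> nat -> nat -> nat) (i : nat) : nat := p i 1%N i.+1.

Section Matrices.
Variables (F : fieldType) (X : finType) (e : rel X).

(* Matrices and vectors indexed by X are indexed by 'I_#|X| via enum_val. *)
Definition distmx (i : nat) : 'M[F]_#|X| :=
  \matrix_(r, s) (dist e (enum_val r) (enum_val s) == i)%:R.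

Definition dual_idem (x : X) (i : nat) : 'M[F]_#|X| :=
  diag_mx (\row_r (dist e x (enum_val r) == i)%:R).

Inductive in_T (x : X) : 'M[F]_#|X| -> Prop :=
| in_T_adj : in_T x (distmx 1)
| in_T_dual i : (i <= diameter e)%N -> in_T x (dual_idem x i)
| in_T_one : in_T x 1%:M
| in_T_add B C : in_T x B -> in_T x C -> in_T x (B + C)
| in_T_scale a B : in_T x B -> in_T x (a *: B)
| in_T_mul B C : in_T x B -> in_T x C -> in_T x (B *m C).

Implicit Types (x : X) (W U : {vspace 'cV[F]_#|X|}).

Definition T_module x W : Prop :=
  forall B w, in_T x B -> w \in W -> B *m w \in W.

Definition T_irreducible x W : Prop :=
  [/\ T_module x W, W <> 0%VS &
      forall U, T_module x U -> (U <= W)%VS -> U = 0%VS \/ U = W].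

(* The subspace E^*_i W. *)
Definition dual_part x W (i : nat) : {vspace 'cV[F]_#|X|} :=
  (linfun (mulmx (dual_idem x i)) @: W)%VS.

Definition thin x W : Prop :=
  forall i : nat, (i <= diameter e)%N -> (\dim (dual_part x W i) <= 1)%N.

(* The value is diameter + 1 when W = 0. *)
Definition endpoint x W : nat :=
  find (fun i => dual_part x W i != 0%VS) (iota 0 (diameter e).+1).

(* When E^*_2 W is one-dimensional, eta is uniquely determined. *)
Definition local_eigenvalue x W (eta : F) : Prop :=
  exists w, [/\ w \in dual_part x W 2, w != 0 &
    (dual_idem x 2 *m distmx 2 *m dual_idem x 2) *m w = eta *: w].

End Matrices.

(* theta 0 > ... > theta D are all the eigenvalues of A, without multiplicity.
   Over the complex numbers, a < b says that b - a is a positive real. *)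
Definition ordered_eigenvalues (C : numClosedFieldType) (n : nat)
    (A : 'M[C]_n) (D : nat) (theta : nat -> C) : Prop :=
  (forall i j : nat, (i < j <= D)%N -> theta j < theta i) /\
  (forall a : C, eigenvalue A a <-> exists2 i : nat, (i <= D)%N & a = theta i).

Definition theta_tilde (F : fieldType) (p : nat -> nat -> nat -> nat) (t : F)
    : F :=
  - 1 - (b_ p 2)%:R * (b_ p 3)%:R * (t ^+ 2 - (b_ p 2)%:R)^-1.

(* Main.v *)
(* With d = D/2 the symmetry of the spectrum of a bipartite graph gives
   theta_d = 0, so the local eigenvalue is b_3 - 1. For an eigenvalue th of A let
   F = sum_j a_j A_j, with a_0 = 1, be the multiple of its primitive idempotent.
   As v is supported at distance 2 from x and its entries sum to 0, <v, A_j v>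
   vanishes unless j is 0, 2 or 4, whence
     k b_1 b_2 <v, F v> = th^2 (k^2 - th^2) <v, v>.
   For th = 0 this yields F v = 0, which forces E*_D A_{D-2} v = 0; thinness then
   makes the span of the E*_{i+2} A_i v with i <= D - 3 a submodule, hence all
   of W. The remaining D - 2 eigenvalues (other than 0, k and -k) each have an
   eigenvector F v <> 0 in W, so dim W >= D - 2. *)
Require Import Defs.
From HB Require Import structures.
From mathcomp Require Import all_boot all_order all_algebra.
From mathcomp Require Import reals.
From mathcomp Require Import complex.
From mathcomp Require Import zify ring.

Set Implicit Arguments.
Unset Strict Implicit.
Unset Printing Implicit Defensive.

Import Order.TTheory GRing.Theory Num.Theory.
Local Open Scope ring_scope.

(** * Eigenvectors of one matrix for distinct eigenvalues *)

Section Eigenvectors.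
Variables (F : fieldType) (n : nat) (M : 'M[F]_n).

(** Applying [M - a] to the relation deletes the term of [a] and multiplies each other term by
    [t - a]. Induction gives [(t - a) *: g t = 0], and [t != a] because [s] has no repetitions. *)
Lemma eigvec_sum_eq0 (s : seq F) (g : F -> 'cV_n) :
  uniq s -> {in s, forall t, M *m g t = t *: g t} ->
  \sum_(t <- s) g t = 0 -> {in s, forall t, g t = 0}.
Proof.
elim: s g => [|a s IH] g //= /andP[as_ us] gP; rewrite big_cons => g0.
have gs t : t \in s -> M *m g t = t *: g t by move=> ts; apply: gP; rewrite inE ts orbT.
pose h t := (t - a) *: g t.
have hP : {in s, forall t, M *m h t = t *: h t}.
  by move=> t /gs gt; rewrite -scalemxAr gt !scalerA mulrC.
have h0 : \sum_(t <- s) h t = 0.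
  have := congr1 (fun w => M *m w - a *: w) g0.
  rewrite mulmx0 scaler0 subr0 mulmxDr gP ?mem_head // scalerDr opprD addrACA subrr.
  rewrite add0r mulmx_sumr scaler_sumr -sumrB => E; rewrite -[RHS]E.
  by rewrite !big_seq; apply: eq_bigr => b bs; rewrite gs // /h scalerBl.
have s0 t : t \in s -> g t = 0.
  move=> ts; have /eqP := IH h us hP h0 t ts.
  rewrite scaler_eq0 subr_eq0 => /orP[|/eqP//].
  by move/eqP => ta; move: as_; rewrite -ta ts.
move=> t; rewrite inE => /orP[/eqP ->|/s0//].
by move: g0; rewrite big_seq big1 ?addr0.
Qed.

Lemma eigvec_free (s : seq F) (g : F -> 'cV_n) :
  uniq s -> {in s, forall t, g t != 0} ->
  {in s, forall t, M *m g t = t *: g t} -> free (map g s).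
Proof.
elim: s => [|a s IH] us g0 gP; first by rewrite nil_free.
have /andP[as_ us'] := us.
have fs : free (map g s).
  by apply: IH => // t ts; [apply: g0|apply: gP]; rewrite inE ts orbT.
rewrite map_cons free_cons fs andbT; apply/negP => /(free_span fs)[c ga _].
have := g0 a (mem_head _ _); rewrite -oppr_eq0 => /eqP; apply.
(* A dependence of [g a] on the other vectors is rewritten as a vanishing sum of eigenvectors, with
   [- g a] as the term of [a]. *)
pose h t := if t == a then - g a else c (g t) *: g t.
rewrite -[LHS](_ : h a = _); last by rewrite /h eqxx.
apply: (eigvec_sum_eq0 us) (mem_head _ _) => [t ts|].
  by rewrite /h; case: eqP => [->|_]; rewrite ?mulmxN -?scalemxAr gP ?mem_head // ?scalerN // !scalerA mulrC.
rewrite big_cons {1}/h eqxx ga big_map addrC; apply/eqP; rewrite subr_eq0; apply/eqP.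
rewrite !big_seq; apply: eq_bigr => t ts; rewrite /h; case: eqP => // ta.
by rewrite -ta ts in as_.
Qed.

(** [vpick] turns the mere existence of eigenvectors in [W] into a function of the eigenvalue, to
    which [eigvec_free] applies. *)
Lemma eigvec_dim (W : {vspace 'cV[F]_n}) (s : seq F) : uniq s ->
  {in s, forall t, exists u, [/\ u \in W, u != 0 & M *m u = t *: u]} ->
  (size s <= \dim W)%N.
Proof.
move=> us sP; pose V t := (W :&: lker (linfun (mulmx (M - t%:M))))%VS.
have VP t u : u \in V t -> u \in W /\ M *m u = t *: u.
  rewrite memv_cap memv_ker => /andP[uW h]; split => //; move: h.
  by rewrite lfunE /= mulmxBl mul_scalar_mx subr_eq0 => /eqP.
rewrite -(size_map (fun t => vpick (V t))).
have /eqnP <- : free (map (fun t => vpick (V t)) s).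
  apply: eigvec_free => // t ts; last by have [] := VP t _ (memv_pick _).
  rewrite vpick0; apply/eqP => V0; have [u [uW un0 uM]] := sP t ts.
  suff : u \in V t by rewrite V0 memv0 (negPf un0).
  by rewrite memv_cap uW memv_ker lfunE /= mulmxBl mul_scalar_mx uM subrr.
apply/dimvS/span_subvP => _ /mapP[t _ ->].
by have [] := VP t _ (memv_pick _).
Qed.

End Eigenvectors.

(** * Symmetry of the spectrum about 0 *)

Lemma ordered_eigenvalues_sorted (C : numClosedFieldType) n (M : 'M[C]_n) D theta :
  ordered_eigenvalues M D theta -> sorted >%O (mkseq theta D.+1).
Proof.
case=> lt_th _; apply/(sortedP 0) => i; rewrite size_mkseq => iD.
by rewrite !nth_mkseq //; [apply: lt_th; lia|lia].
Qed.

(** The lists theta_0, ..., theta_D and -theta_D, ..., -theta_0 are strictly decreasing with the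
    same members, so they coincide. For even D the middle entry is its own negative. *)
Lemma ordered_eigenvalues_mid (C : numClosedFieldType) n (M : 'M[C]_n) D theta :
  ordered_eigenvalues M D theta -> (forall a, eigenvalue M a -> eigenvalue M (- a)) ->
  ~~ odd D -> theta D./2 = 0.
Proof.
move=> th_ord symM oD; have [lt_th thP] := th_ord; pose s1 := mkseq theta D.+1.
pose s2 := mkseq (fun i => - theta (D - i)%N) D.+1.
have s12 : s1 = s2.
  apply: (@irr_sorted_eq _ >%O).
  - by move=> b a c ba cb; apply: lt_trans cb ba.
  - exact: ltxx.
  - exact: ordered_eigenvalues_sorted th_ord.
  - apply/(sortedP 0) => i; rewrite size_mkseq => iD; rewrite !nth_mkseq //; last by lia.
    by rewrite /= ltrN2; apply: lt_th; lia.
  move=> a; apply/mapP/mapP => -[m]; rewrite mem_iota => /andP[_ mD] ->.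
    have /symM/thP[j jD ij] : eigenvalue M (theta m) by apply/thP; exists m => //; lia.
    by exists (D - j)%N; [rewrite mem_iota; lia|rewrite subKn // -ij opprK].
  have /symM/thP[j jD ->] : eigenvalue M (theta (D - m)%N).
    by apply/thP; exists (D - m)%N => //; lia.
  by exists j => //; rewrite mem_iota; lia.
have /(congr1 (fun s => nth 0 s D./2)) := s12.
rewrite !nth_mkseq; [|lia|lia].
rewrite (_ : (D - D./2 = D./2)%N); last by lia.
by move=> /eqP; rewrite -addr_eq0 -mulr2n mulrn_eq0 => /eqP.
Qed.

(** Changing the sign of an eigenvector on one colour class negates its eigenvalue. *)
Lemma bipartite_eigenvalueN (F : fieldType) (X : finType) (e : rel X) a :
  bipartite e -> (forall y z, (dist e y z == 1%N) = e y z) ->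
  eigenvalue (distmx F e 1) a -> eigenvalue (distmx F e 1) (- a).
Proof.
move=> [f fP] d1 /eigenvalueP[u uA u0].
pose s (r : 'I_#|X|) : F := (-1) ^+ f (enum_val r).
have ss r : s r * s r = 1 by rewrite -expr2 sqrr_sign.
apply/eigenvalueP; exists (\row_r (u 0 r * s r)).
  apply/rowP => j; move: uA => /rowP/(_ j); rewrite !mxE => uA.
  rewrite mulNr mulrA -uA mulr_suml -sumrN; apply: eq_bigr => r _.
  rewrite !mxE d1; case: (boolP (e _ _)) => [/fP fr|_]; last by rewrite !mulr0 mul0r oppr0.
  by rewrite !mulr1 -mulrN /s; congr (_ * _); case: (f _) (f _) fr => [] [] //; rewrite ?opprK.
apply: contraNneq u0 => /rowP us; apply/eqP/rowP => r.
by have := us r; rewrite !mxE => /(congr1 ( *%R^~ (s r))); rewrite -mulrA ss mulr1 mul0r.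
Qed.

(** * Walks, distances and parity *)

Section BipartiteDistanceRegular.
Variables (X : finType) (e : rel X).
Hypotheses (e_sym : symmetric e) (e_irr : irreflexive e).
Hypothesis e_conn : connected_graph e.
Variable x0 : X.
Local Open Scope nat_scope.
Local Notation dist := (dist e).
Local Notation D := (diameter e).
Implicit Types (y z w : X) (n m : nat).

Lemma walkP n y z :
  reflect (exists s, [/\ size s = n, path e y s & last y s = z]) (walk e n y z).
Proof.
apply: (iffP existsP) => [[s /andP[ys /eqP <-]]|[s [/eqP sn ys <-]]].
  by exists s; rewrite size_tuple.
by exists (Tuple sn); rewrite /= ys eqxx.
Qed.

Lemma walk_cat m n y w z : walk e m y w -> walk e n w z -> walk e (m + n) y z.
Proof.
move=> /walkP[s [<- ys <-]] /walkP[t [<- wt <-]]; apply/walkP; exists (s ++ t).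
by rewrite size_cat cat_path ys wt last_cat.
Qed.

Lemma walk_sym n y z : walk e n y z = walk e n z y.
Proof.
wlog suff: y z / walk e n y z -> walk e n z y by move=> H; apply/idP/idP; apply: H.
move=> /walkP[s [<- ys <-]]; apply/walkP; exists (rev (belast y s)).
split; first by rewrite size_rev size_belast.
  by rewrite rev_path; under eq_path do rewrite e_sym.
by case: s {ys} => //= a s; rewrite rev_cons last_rcons.
Qed.

Lemma dist_walk n y z : walk e n y z -> dist y z <= n.
Proof.
(* For [n] at least [#|X|] the bound is automatic, since [find] never exceeds the length of the list
   searched. *)
move=> yz; case: (ltnP n #|X|) => [nX|]; last first.
  by apply: leq_trans; rewrite -[leqRHS](size_iota 0) find_size.
rewrite leqNgt; apply/negP => /(before_find 0).
by rewrite nth_iota // add0n yz.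
Qed.

Lemma walk_dist y z : walk e (dist y z) y z.
Proof.
have /hasP h : exists2 n, n \in iota 0 #|X| & walk e n y z.
  (* A path without repeated vertices has fewer than [#|X|] steps, so the bounded search that
     defines [dist] succeeds. *)
  have /connectP[s ys ->] := e_conn y z; case/shortenP: ys => t yt ut _.
  exists (size t); last by apply/walkP; exists t.
  by rewrite mem_iota add0n /=; have := max_card (mem (y :: t)); rewrite (card_uniqP ut).
have := nth_find 0 h; rewrite nth_iota ?add0n //.
by move: h; rewrite has_find size_iota.
Qed.

Lemma dist_sym y z : dist y z = dist z y.
Proof. by apply/eq_find => n; rewrite walk_sym. Qed.

Lemma dist_triangle y w z : dist y z <= dist y w + dist w z.
Proof. exact: dist_walk (walk_cat (walk_dist y w) (walk_dist w z)). Qed.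

Lemma dist_eq0 y z : (dist y z == 0) = (y == z).
Proof.
apply/eqP/eqP => [d0|->].
  by have /walkP[s [+ _ <-]] := walk_dist y z; rewrite d0 => /size0nil ->.
by apply/eqP; rewrite -leqn0; apply/dist_walk/walkP; exists [::].
Qed.

Lemma distxx y : dist y y = 0.
Proof. by apply/eqP; rewrite dist_eq0. Qed.

Lemma dist_eq1 y z : (dist y z == 1) = e y z.
Proof.
apply/eqP/idP => [d1|yz].
  have /walkP[s [+ + <-]] := walk_dist y z; rewrite d1.
  by case: s => [|a [|]] //= _; rewrite andbT.
apply/eqP; rewrite eqn_leq; apply/andP; split.
  by apply/dist_walk/walkP; exists [:: z]; rewrite /= yz.
by rewrite lt0n dist_eq0; apply: contraTneq yz => ->; rewrite e_irr.
Qed.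

Lemma dist_pred n y z : dist y z = n.+1 -> exists2 w, e y w & dist w z = n.
Proof.
move=> yz; have /walkP[s []] := walk_dist y z; rewrite yz.
case: s => [|w s] //= -[sn] /andP[yw ws] lz.
exists w => //; apply/eqP; rewrite eqn_leq; apply/andP; split.
  by rewrite -sn; apply/dist_walk/walkP; exists s.
have := dist_triangle y w z; rewrite yz; move: yw; rewrite -dist_eq1 => /eqP->.
by rewrite add1n.
Qed.

Lemma dist_diameter y z : dist y z <= diameter e.
Proof. exact: leq_trans (@bigop.leq_bigmax X (dist y) z) (@bigop.leq_bigmax X (fun y => \max_(z : X) dist y z) y). Qed.

(** Start from a pair at maximal distance and move one end towards the other, one step at a time. *)
Lemma exists_dist j : j <= diameter e -> exists y z, dist y z = j.
Proof.
move=> jD; rewrite -(subKn jD); elim: (_ - j) => [|i [y [z yz]]].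
  have X0 : #|X| > 0 by apply/card_gt0P; exists x0.
  have [y Hy] := @bigop.eq_bigmax X (fun y => \max_(z : X) dist y z) X0.
  have [z Hz] := @bigop.eq_bigmax X (dist y) X0.
  by exists y, z; rewrite subn0 /diameter Hy Hz.
rewrite subnS; case E: (diameter e - i) yz => [|m] yz; first by exists y, z.
by have [w _ wz] := dist_pred yz; exists w, z.
Qed.

Hypothesis e_bip : bipartite e.

(** Each edge switches the colour, so a distance is odd exactly when its ends have different
    colours. *)
Lemma odd_dist y w z : odd (dist y z) = odd (dist y w) (+) odd (dist w z).
Proof.
have [f fE] := e_bip.
have par a b : odd (dist a b) = (f a != f b).
  have /walkP[s [<- + <-]] := walk_dist a b.
  elim: s a => [|c s IH] a /=; first by rewrite eqxx.
  by case/andP => /fE ac /IH ->; move: ac; by case: (f a); case: (f c); case: (f (last c s)).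
by rewrite !par; case: (f y); case: (f w); case: (f z).
Qed.

(** * Intersection numbers *)

Variables (p : nat -> nat -> nat -> nat) (k : nat).
Hypotheses (e_dr : distance_regular e p) (e_reg : regular_of_valency e k).

(** By the triangle inequality and parity, a neighbour of y lies at distance h - 1 or h + 1 from z.
    Hence only c_h = [p h 1 h.-1] and b_h = [p h 1 h.+1] survive. *)
Lemma intnum_eq0 h j : h <= D -> j != h.+1 -> h != j.+1 -> p h 1 j = 0.
Proof.
move=> hD jh hj; have [y [z yz]] := exists_dist hD.
rewrite -yz -e_dr; apply: eq_card0 => w; rewrite inE; apply/negP.
case/andP=> /eqP yw /eqP zw.
have := odd_dist y w z.
have := dist_triangle y w z; have := dist_triangle w y z.
rewrite (dist_sym w z) (dist_sym w y) yw zw yz; lia.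
Qed.

Lemma intnum_succ_gt0 j : j < D -> 0 < p j 1 j.+1.
Proof.
move=> jD; have [y [z yz]] := exists_dist jD.
have [w yw wz] := dist_pred yz.
rewrite -{1}wz -e_dr; apply/card_gt0P; exists y.
by rewrite inE dist_eq1 // e_sym yw dist_sym // yz /=.
Qed.

Lemma intnum_pred_gt0 j : j < D -> 0 < p j.+1 1 j.
Proof.
move=> jD; have [y [z yz]] := exists_dist jD.
have [w yw wz] := dist_pred yz.
rewrite -{1}yz -e_dr; apply/card_gt0P; exists w.
by rewrite inE dist_eq1 // yw dist_sym // wz /=.
Qed.

(** This is c_i + b_i = k for i = j + 1: by parity every neighbour of y is either one step closer to
    z or one step further. *)
Lemma intnum_addn j : j < D -> p j.+1 1 j + p j.+1 1 j.+2 = k.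
Proof.
move=> jD; have [y [z yz]] := exists_dist jD.
rewrite -yz -!e_dr -(e_reg y) -cardsUI.
rewrite (_ : _ :&: _ = set0) ?cards0 ?addn0; last first.
  by apply/setP => w; rewrite !inE; lia.
congr #|pred_of_set _|; apply/setP => w; rewrite !inE -dist_eq1 yz.
have := odd_dist y w z.
have := dist_triangle y w z; have := dist_triangle w y z.
rewrite (dist_sym w z) (dist_sym w y) yz; lia.
Qed.

Lemma intnum_valency : p 0 1 1 = k.
Proof.
rewrite -{1}(distxx x0) -e_dr -(e_reg x0); congr #|pred_of_set _|.
by apply/setP => w; rewrite !inE andbb dist_eq1.
Qed.

Lemma intnum_pred1 : 0 < D -> p 1 1 0 = 1.
Proof.
move=> D0; have [y [z yz]] := exists_dist D0.
rewrite -{1}yz -e_dr; suff -> : [set w | (dist y w == 1) && (dist z w == 0)] = [set z].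
  exact: cards1.
apply/setP => w; rewrite !inE dist_eq0 // (eq_sym z); case: (w =P z) => [->|]; last by rewrite andbF.
by rewrite yz.
Qed.

Lemma card_sphere y h : #|[set w | dist y w == h]| = p 0 h h.
Proof.
rewrite -{1}(distxx y) -e_dr; congr #|pred_of_set _|.
by apply/setP => w; rewrite !inE andbb.
Qed.

Lemma sphere_gt0 h : h <= D -> 0 < p 0 h h.
Proof.
move=> hD; have [y [z yz]] := exists_dist hD.
by rewrite -(card_sphere y); apply/card_gt0P; exists z; rewrite inE yz.
Qed.

(* Both sides count the pairs (z, w) with w adjacent to z, at distances h and j
   from a fixed vertex. *)
Lemma intnum_sym h j : p 0 h h * p h 1 j = p 0 j j * p j 1 h.
Proof.
have count i l : p 0 i i * p i 1 l =
    \sum_z \sum_w [&& dist x0 z == i, dist z w == 1 & dist x0 w == l].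
  rewrite -(card_sphere x0) -sum1dep_card big_distrl /= [RHS]big_mkcond /=.
  rewrite big_mkcond /=; apply: eq_bigr => z _; case: eqP => [xz|_]; last by rewrite big1.
  rewrite mul1n -xz dist_sym -e_dr -sum1dep_card big_mkcond /=.
  by apply: eq_bigr => w _; rewrite dist_sym //; case: (_ && _).
rewrite !count exchange_big; apply: eq_bigr => w _; apply: eq_bigr => z _.
rewrite (dist_sym w z); congr nat_of_bool.
by case: (dist x0 z == h); case: (dist z w == 1); case: (dist x0 w == j).
Qed.


(** * Distance matrices acting on functions on the vertices *)

Local Open Scope ring_scope.
Variable C : numClosedFieldType.
Local Notation A := (distmx C e).
Implicit Types (u : 'cV[C]_#|X|).

Definition vat u (y : X) : C := u (enum_rank y) 0.

Lemma sum_vertex (G : X -> C) : \sum_(r < #|X|) G (enum_val r) = \sum_y G y.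
Proof. by rewrite [RHS](reindex _ (onW_bij _ (@enum_val_bij X))). Qed.

Lemma vatP u u' : (forall y, vat u y = vat u' y) -> u = u'.
Proof. by move=> uu; apply/colP => r; have := uu (enum_val r); rewrite /vat enum_valK. Qed.

Lemma vatD u u' y : vat (u + u') y = vat u y + vat u' y.
Proof. exact: mxE. Qed.

Lemma vatZ a u y : vat (a *: u) y = a * vat u y.
Proof. exact: mxE. Qed.

Lemma vat0 y : vat 0 y = 0.
Proof. exact: mxE. Qed.

Lemma vat_sum (I : Type) (r : seq I) (Q : pred I) (F : I -> 'cV[C]_#|X|) y :
  vat (\sum_(i <- r | Q i) F i) y = \sum_(i <- r | Q i) vat (F i) y.
Proof. exact: summxE. Qed.

Lemma vat_distmx j u y : vat (A j *m u) y = \sum_z (dist y z == j)%:R * vat u z.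
Proof.
rewrite /vat mxE -sum_vertex; apply: eq_bigr => r _.
by rewrite mxE enum_rankK enum_valK.
Qed.

Lemma vat_dual x j u y : vat (dual_idem C e x j *m u) y = (dist x y == j)%:R * vat u y.
Proof. by rewrite /vat mul_diag_mx !mxE enum_rankK. Qed.

Lemma distmx0 : A 0 = 1%:M.
Proof. by apply/matrixP => r s; rewrite !mxE dist_eq0 (inj_eq enum_val_inj). Qed.

Lemma distmx_gt j : (D < j)%N -> A j = 0.
Proof.
move=> Dj; apply/matrixP => r s; rewrite !mxE.
by have := dist_diameter (enum_val r) (enum_val s); case: eqP => // ->; lia.
Qed.

Lemma trmx_distmx j : (A j)^T = A j.
Proof. by apply/matrixP => r s; rewrite !mxE dist_sym. Qed.

(** The (y, z) entry of the product counts the neighbours of y at distance j from z, a number that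
    depends only on [dist y z]. *)
Lemma distmx_mul1 j : A 1 *m A j = \sum_(h < D.+1) (p h 1 j)%N%:R *: A h.
Proof.
apply/matrixP => r s; rewrite summxE mxE.
set y := enum_val r; set z := enum_val s.
rewrite (bigD1 (Ordinal (dist_diameter y z : (dist y z < D.+1)%N))) //= [X in _ = _ + X]big1 => [|h].
  rewrite !mxE eqxx mulr1 addr0 -e_dr.
  rewrite (eq_bigr (fun t => ((dist y (enum_val t) == 1%N)
      && (dist z (enum_val t) == j))%:R)) => [|t _].
    by rewrite (sum_vertex (fun w => ((dist y w == 1%N) && (dist z w == j))%:R)) -sum1_card natr_sum [RHS]big_mkcond /=;
      apply: eq_bigr => w _; rewrite inE; case: (_ && _).
  by rewrite !mxE (dist_sym z) -natrM mulnb.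
rewrite -val_eqE /= => hyz; rewrite !mxE -/y -/z.
by rewrite eq_sym (negPf hyz) mulr0.
Qed.

(** The three-term recurrence A A_j = b_{j-1} A_{j-1} + c_{j+1} A_{j+1}, solved for its last
    term. *)
Lemma distmx_step j : (j < D)%N ->
  (p j.+1 1 j)%N%:R *: A j.+1
    = A 1 *m A j - if j is i.+1 then (p i 1 i.+1)%N%:R *: A i else 0.
Proof.
move=> jD; rewrite distmx_mul1.
have jD1 : (j.+1 < D.+1)%N by [].
rewrite (bigD1 (Ordinal jD1)) //=; case: j jD jD1 => [|i] jD jD1.
  rewrite subr0 big1 ?addr0 // => h; rewrite -val_eqE /= => h1.
  by rewrite intnum_eq0 ?scale0r //; have := ltn_ord h; lia.
have iD : (i < D.+1)%N by lia.
rewrite (bigD1 (Ordinal iD)) /=; last by rewrite -val_eqE /=; lia.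
rewrite big1 ?addr0 ?addrK // => h; rewrite -!val_eqE /= => /andP[h1 h2].
by rewrite intnum_eq0 ?scale0r //; have := ltn_ord h; lia.
Qed.

(** An induction form of the fact that every [A j] is a polynomial in [A 1]: the recurrence can be
    divided by c_{j+1}, which is positive. Beyond the diameter [A j] is 0, obtained as 0 times the
    identity. *)
Lemma distmx_ind (P : 'M[C]_#|X| -> Prop) : P 1%:M -> 
  (forall B B', P B -> P B' -> P (B + B')) -> (forall a B, P B -> P (a *: B)) ->
  (forall B, P B -> P (A 1 *m B)) -> forall j, P (A j).
Proof.
move=> P1 PD PZ PM j; case: (ltnP D j) => [/distmx_gt ->|].
  by rewrite -(scale0r 1%:M); apply: PZ.
elim/ltn_ind: j => -[|j] IH jD; first by rewrite distmx0.
have c0 : (p j.+1 1 j)%N%:R != 0 :> C by rewrite pnatr_eq0 -lt0n intnum_pred_gt0.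
rewrite -[A _]scale1r -(mulVf c0) -scalerA distmx_step //; apply/PZ/PD.
  by apply: PM; apply: IH => //; lia.
case: j IH jD {c0} => [|i] IH jD; rewrite -scaleN1r; apply: (PZ).
  by rewrite -(scale0r 1%:M); apply: PZ.
by apply: PZ; apply: IH; lia.
Qed.

Lemma distmx_in_T x j : in_T e x (A j).
Proof.
apply: distmx_ind => [|B B'|a B|B]; [exact: in_T_one|exact: in_T_add|exact: in_T_scale|].
by apply: in_T_mul; apply: in_T_adj.
Qed.

(** A polynomial in [A 1] acts as a scalar wherever [A 1] does. The width [n] is free so that one
    [g] serves both vectors and the matrix [eigmx a]. *)
Lemma distmx_eigen j th : exists g, forall n (B : 'M_(_, n)),
  A 1 *m B = th *: B -> A j *m B = g *: B.
Proof.
pose P (M : 'M[C]_#|X|) := exists g, forall n (B : 'M_(_, n)),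
  A 1 *m B = th *: B -> M *m B = g *: B.
apply: (distmx_ind (P := P)) => [|B B' [g gP] [g' gP']|a B [g gP]|B [g gP]].
- by exists 1 => n B _; rewrite mul1mx scale1r.
- by exists (g + g') => n M AM; rewrite mulmxDl gP // gP' // scalerDl.
- by exists (a * g) => n M AM; rewrite -scalemxAl gP // scalerA.
by exists (g * th) => n M AM; rewrite -mulmxA gP // -scalemxAr AM scalerA.
Qed.

(** * Primitive idempotents *)

(** The cosine sequence of [th]: the equation A F = th F for F = sum_j a_j A_j, read off coefficient
    by coefficient and normalized by a_0 = 1. *)
Definition eigseq (th : C) (a : nat -> C) : Prop :=
  a 0%N = 1 /\ forall h, (h <= D)%N -> \sum_(j < D.+1) (p h 1 j)%N%:R * a j = th * a h.

Definition eigmx (a : nat -> C) : 'M[C]_#|X| := \sum_(j < D.+1) a j *: A j.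

Lemma eigmxP th a : eigseq th a -> A 1 *m eigmx a = th *: eigmx a.
Proof.
move=> [_ aP]; rewrite mulmx_sumr.
under eq_bigr => j _ do rewrite -scalemxAr distmx_mul1 scaler_sumr.
rewrite exchange_big scaler_sumr; apply: eq_bigr => h _ /=.
rewrite scalerA -aP ?scaler_suml -1?ltnS //; apply: eq_bigr => j _.
by rewrite scalerA mulrC.
Qed.

(* The value at one vertex of [A j] applied to an eigenvector is, up to
   normalization, the eigenvalue of [A j]; dividing by the size of a sphere
   turns it into the coefficient of [A j] in the primitive idempotent. *)
Lemma exists_eigseq th : eigenvalue (A 1) th -> exists a, eigseq th a.
Proof.
move=> /eigenvalueP[u0 /(congr1 trmx)]; rewrite trmx_mul trmx_distmx linearZ /=.
move=> uth un0; set u := u0^T in uth.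
have [y0 uy] : exists y, vat u y != 0.
  apply/existsP; apply: contraNT un0; rewrite negb_exists => /forallP u00.
  rewrite -trmx_eq0; apply/eqP/vatP => y; rewrite vat0; apply/eqP.
  by have := u00 y; rewrite negbK.
exists (fun j => vat (A j *m u) y0 / (p 0 j j)%N%:R / vat u y0); split.
  by rewrite distmx0 mul1mx -(card_sphere y0) (eq_card1 (x := y0)) ?divr1 ?divff // => w;
    rewrite inE dist_eq0 eq_sym.
move=> h hD; have hk j : (j <= D)%N -> (p 0 j j)%N%:R != 0 :> C.
  by move=> jD; rewrite pnatr_eq0 -lt0n sphere_gt0.
(* [A h *m u] is a multiple of [u], so multiplying it by [th] amounts to applying [A 1]. *)
have -> : th * (vat (A h *m u) y0 / (p 0 h h)%N%:R / vat u y0)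
    = vat (A 1 *m (A h *m u)) y0 / (p 0 h h)%N%:R / vat u y0.
  have [g gP] := distmx_eigen h th; rewrite gP // -scalemxAr uth !vatZ; ring.
rewrite mulmxA distmx_mul1 mulmx_suml vat_sum !mulr_suml; apply: eq_bigr => j _.
rewrite -scalemxAl vatZ !mulrA; congr (_ / _).
rewrite -mulrA mulrCA [RHS]mulrAC mulrC; congr (_ * _).
(* The product rule yields the coefficient [p j 1 h], while [eigseq] asks for [p h 1 j]; the ratio
   of the sphere sizes converts one into the other. *)
have := congr1 (fun n => n%:R : C) (intnum_sym h j); rewrite !natrM => E.
have kj : (p 0 j j)%N%:R != 0 :> C by apply: hk; rewrite -ltnS.
apply: (mulfI (hk _ hD)); rewrite mulrA E; have := hk _ hD => kh.
by field; rewrite kj kh.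
Qed.

Lemma eigseq1 th a : (0 < D)%N -> eigseq th a -> k%:R * a 1%N = th.
Proof.
move=> D0 [a0 aP]; have := aP 0 isT; rewrite a0 mulr1 => <-.
have D1 : (1 < D.+1)%N by [].
rewrite (bigD1 (Ordinal D1)) //= big1 ?addr0 ?intnum_valency // => h.
by rewrite -val_eqE /= => h1; rewrite intnum_eq0 ?mul0r //; have := ltn_ord h; lia.
Qed.

Lemma eigseq_step th a i : (i.+1 < D)%N -> eigseq th a ->
  (p i.+1 1 i)%N%:R * a i + (p i.+1 1 i.+2)%N%:R * a i.+2 = th * a i.+1.
Proof.
move=> iD [a0 aP]; rewrite -aP; last exact: ltnW.
have i1 : (i < D.+1)%N by lia.
have i2 : (i.+2 < D.+1)%N by lia.
rewrite (bigD1 (Ordinal i1)) // (bigD1 (Ordinal i2)) /=; last by rewrite -val_eqE /=; lia.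
rewrite big1 ?addr0 // => h; rewrite -!val_eqE /= => /andP[h1 h2].
by rewrite intnum_eq0 ?mul0r //; have := ltn_ord h; lia.
Qed.

(** The weights 1, b_3 - 1, -b_3 are those of <v, F v> when the local eigenvalue is b_3 - 1. The
    factor k b_1 b_2 clears the denominators of a_1, a_2, a_3; a_4 already comes multiplied by
    b_3. *)
Lemma eigseq_quadratic th a : (4 <= D)%N -> eigseq th a ->
  let b := (p 3 1 4)%N%:R in
  k%:R * (p 1 1 2)%N%:R * (p 2 1 3)%N%:R * (a 0%N + (b - 1) * a 2%N - b * a 4%N)
    = th ^+ 2 * (k%:R ^+ 2 - th ^+ 2).
Proof.
move=> D4 aP b; have a0 : a 0%N = 1 by case: aP.
have D0 : (0 < D)%N by lia.
have nk i : (i < D)%N -> (p i.+1 1 i)%N%:R + (p i.+1 1 i.+2)%N%:R = k%:R :> C.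
  by move=> iD; rewrite -natrD intnum_addn.
have := nk 0 D0; have := nk 1 ltac:(lia); have := nk 2 ltac:(lia).
have := eigseq_step (i := 2) ltac:(lia) aP; have := eigseq_step (i := 1) ltac:(lia) aP.
have := eigseq_step (i := 0) ltac:(lia) aP; have := eigseq1 D0 aP.
rewrite intnum_pred1 // a0 -/b.
move: (a 1%N) (a 2%N) (a 3%N) (a 4%N) => a1 a2 a3 a4.
move: (p 1 1 2)%N%:R (p 2 1 1)%N%:R (p 2 1 3)%N%:R (p 3 1 2)%N%:R b k%:R => b1 c2 b2 c3 b3 K.
move=> E1 E2 E3 E4 F3 F2 F1.
(* Elimination runs from a_4 downwards, replacing each b_i a_{i+1} by the recurrence and expressing
   c_2, c_3 and b_1 through k, b_2 and b_3. *)
have Eb : b3 * a4 = th * a3 - c3 * a2 by rewrite -E4; ring.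
have Ec : c3 = K - b3 by rewrite -F3; ring.
have Eb1 : b1 = K - 1 by rewrite -F1; ring.
have Ec2 : c2 = K - b2 by rewrite -F2; ring.
rewrite Eb Ec.
have -> : K * b1 * b2 * (1 + (b3 - 1) * a2 - (th * a3 - (K - b3) * a2))
   = K * b1 * (b2 + b2 * ((K - 1) * a2) - th * (b2 * a3)) by ring.
have E2' : (K - 1) * a2 = th * a1 - 1 by rewrite -Eb1 -E2; ring.
have E3' : b2 * a3 = th * a2 - c2 * a1 by rewrite -E3; ring.
rewrite E2' E3' Ec2.
have -> : K * b1 * (b2 + b2 * (th * a1 - 1) - th * (th * a2 - (K - b2) * a1))
   = th * (b1 * K * (K * a1) - K * th * (b1 * a2)) by ring.
rewrite E1 Eb1 E2' -E1; ring.
Qed.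

(** For th = 0 the recurrence reads c_{i+1} a_i = - b_{i+1} a_{i+2} with c_{i+1} > 0, so
    nonvanishing passes from a_0 = 1 to all even indices. *)
Lemma eigseq0_neq0 a i : ~~ odd i -> (i <= D)%N -> eigseq 0 a -> a i != 0.
Proof.
move=> + + aP; elim/ltn_ind: i => -[|[|i]] IH //= io iD.
  by case: aP => -> _; rewrite oner_eq0.
have := eigseq_step iD aP; rewrite mul0r => E.
have ai : a i != 0 by apply: IH => //; [lia|lia].
apply: contra_eq_neq E => ->; rewrite mulr0 addr0 mulf_neq0 //.
by rewrite pnatr_eq0 -lt0n intnum_pred_gt0 //; lia.
Qed.

(** Equality would turn the recurrence into (c_{i+1} + b_{i+1}) a_i = 0, although both factors are
    nonzero. *)
Lemma eigseq0_neq a i : ~~ odd i -> (i.+1 < D)%N -> eigseq 0 a -> a i != a i.+2.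
Proof.
move=> io iD aP; have := eigseq_step iD aP; rewrite mul0r => E.
have := eigseq0_neq0 io (ltnW (ltnW iD)) aP => ai.
apply: contra_eq_neq E => <-; rewrite -mulrDl -natrD mulf_neq0 //.
by rewrite pnatr_eq0 -lt0n addn_gt0 intnum_pred_gt0 //; lia.
Qed.

(** * The Hermitian form, for which distance matrices are self-adjoint *)

Definition herm u u' := \sum_y (vat u y)^* * vat u' y.

Lemma herm_distmx j u u' : herm (A j *m u) u' = herm u (A j *m u').
Proof.
rewrite /herm; under eq_bigr do rewrite vat_distmx rmorph_sum mulr_suml /=.
rewrite exchange_big; apply: eq_bigr => z _; rewrite vat_distmx mulr_sumr.
by apply: eq_bigr => y _; rewrite rmorphM rmorph_nat dist_sym mulrCA mulrA.
Qed.

Lemma herm_sum (I : Type) (r : seq I) (c : I -> C) (F : I -> 'cV[C]_#|X|) u :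
  herm u (\sum_(i <- r) c i *: F i) = \sum_(i <- r) c i * herm u (F i).
Proof.
rewrite /herm; under eq_bigr do rewrite vat_sum mulr_sumr.
rewrite exchange_big; apply: eq_bigr => i _; rewrite mulr_sumr.
by apply: eq_bigr => y _; rewrite vatZ mulrCA.
Qed.

Lemma herm_suml (I : Type) (r : seq I) (c : I -> C) (F : I -> 'cV[C]_#|X|) u :
  herm (\sum_(i <- r) c i *: F i) u = \sum_(i <- r) (c i)^* * herm (F i) u.
Proof.
rewrite /herm; under eq_bigr do rewrite vat_sum rmorph_sum mulr_suml.
rewrite exchange_big; apply: eq_bigr => i _; rewrite mulr_sumr.
by apply: eq_bigr => y _; rewrite vatZ rmorphM mulrA.
Qed.

Lemma hermZ c u u' : herm u (c *: u') = c * herm u u'.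
Proof. by rewrite mulr_sumr; apply: eq_bigr => y _; rewrite vatZ mulrCA. Qed.

Lemma herm_eq0 u : herm u u = 0 -> u = 0.
Proof.
move=> /eqP; rewrite psumr_eq0 => [/allP u0|y _]; last by rewrite mulrC mul_conjC_ge0.
apply: vatP => y; rewrite vat0; apply/eqP.
by have := u0 y (mem_index_enum _); rewrite mulrC mul_conjC_eq0.
Qed.

Lemma eigmx_mulv a u : eigmx a *m u = \sum_(j < D.+1) a j *: (A j *m u).
Proof. by rewrite mulmx_suml; apply: eq_bigr => j _; rewrite scalemxAl. Qed.

(* [eigmx a] is a scalar multiple of an orthogonal projection. *)
Lemma eigmx_isotropic th a u :
  eigseq th a -> herm u (eigmx a *m u) = 0 -> eigmx a *m u = 0.
Proof.
(* Only the left factor is expanded. Each [A j] then moves across the form and acts on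
   [eigmx a *m u] as a scalar, so every term is a multiple of [herm u (eigmx a *m u)]. *)
move=> aP q0; apply: herm_eq0; rewrite {1}eigmx_mulv herm_suml big1 // => j _.
have [g gP] := distmx_eigen j th.
by rewrite herm_distmx mulmxA (gP _ _ (eigmxP aP)) -scalemxAl hermZ q0 !mulr0.
Qed.

(** * Vectors supported at distance two from x *)

Section Endpoint2.
Variables (x : X) (v : 'cV[C]_#|X|) (eta : C).
Hypothesis v_supp : forall y, dist x y != 2%N -> vat v y = 0.
Hypothesis v_sum : \sum_y vat v y = 0.
Hypothesis v_eta : dual_idem C e x 2 *m (A 2 *m v) = eta *: v.
Hypothesis D4 : (4 <= D)%N.

Lemma herm_distmx2 : herm v (A 2 *m v) = eta * herm v v.
Proof.
rewrite -hermZ -v_eta; apply: eq_bigr => y _; rewrite vat_dual.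
by case: eqP => [|/eqP /v_supp ->]; rewrite ?mul1r ?rmorph0 ?mul0r.
Qed.

(** Two vertices at distance 2 from x are at even distance at most 4 from each other. *)
Lemma herm_distmx_eq0 j : j \notin [:: 0; 2; 4]%N -> herm v (A j *m v) = 0.
Proof.
move=> j024; apply: big1 => y _; rewrite vat_distmx.
have [xy|/v_supp ->] := eqVneq (dist x y) 2%N; last by rewrite rmorph0 mul0r.
rewrite big1 ?mulr0 // => z _.
have [xz|/v_supp ->] := eqVneq (dist x z) 2%N; last by rewrite mulr0.
have := odd_dist y x z; have := dist_triangle y x z; rewrite !(dist_sym y x) xy xz.
by case: eqP => [-> yj|]; rewrite ?mul0r //; move: j024; rewrite !inE; lia.
Qed.

(** The sum of all [A j] is the all-ones matrix, which kills [v] because the entries of [v] sum to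
    0. *)
Lemma herm_distmx_sum : \sum_(j < D.+1) herm v (A j *m v) = 0.
Proof.
rewrite exchange_big big1 // => y _; rewrite -mulr_sumr -vat_sum -mulmx_suml.
have -> : vat ((\sum_(j < D.+1) A j) *m v) y = \sum_z vat v z.
  rewrite mulmx_suml vat_sum; under eq_bigr do rewrite vat_distmx.
  rewrite exchange_big; apply: eq_bigr => z _ /=; rewrite -mulr_suml.
  rewrite (bigD1 (Ordinal (dist_diameter y z : (dist y z < D.+1)%N))) //= eqxx.
  rewrite big1 ?addr0 ?mul1r // => j; rewrite -val_eqE /= eq_sym.
  by move=> /negPf ->.
by rewrite v_sum mulr0.
Qed.

Lemma sum_ord024 (c : nat -> C) : (forall j, j \notin [:: 0; 2; 4]%N -> c j = 0) ->
  \sum_(j < D.+1) c j = c 0%N + c 2%N + c 4%N.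
Proof.
move=> c0; have -> : D.+1 = (5 + (D - 4))%N by lia.
rewrite big_split_ord /= [X in _ + X]big1 ?addr0 => [|i _]; last first.
  by apply: c0; rewrite !inE; lia.
by rewrite !big_ord_recl big_ord0 /= (c0 1) // (c0 3) // !add0r addr0 addrA.
Qed.

(** Only j = 0, 2, 4 contribute. The j = 2 term is given by [eta], and the vanishing total then
    forces <v, A_4 v> = -(1 + eta) <v, v>. *)
Lemma herm_eigmx a : a 0%N = 1 ->
  herm v (eigmx a *m v) = (a 0%N + eta * a 2%N - (1 + eta) * a 4%N) * herm v v.
Proof.
move=> a0; rewrite eigmx_mulv herm_sum.
have := herm_distmx_sum; rewrite (sum_ord024 herm_distmx_eq0).
rewrite (sum_ord024 (c := fun j => a j * herm v (A j *m v))); last first.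
  by move=> j /herm_distmx_eq0 ->; rewrite mulr0.
rewrite distmx0 mul1mx herm_distmx2 => /eqP; rewrite addrC addr_eq0 => /eqP->; ring.
Qed.

(** Seen from y at distance D from x, the support of [v] lies at distances D - 2 and D only. The
    zero sum and F v = 0 give two linear equations for the values of A_{D-2} v and A_D v at y,
    independent because a_{D-2} and a_D differ. *)
Lemma eigmx_top a : ~~ odd D -> eigseq 0 a -> eigmx a *m v = 0 ->
  dual_idem C e x D *m A (D - 2) *m v = 0.
Proof.
move=> oD aP Fv; apply: vatP => y; rewrite vat0 -mulmxA vat_dual.
have [xy|_] := eqVneq (dist x y) D; last by rewrite mul0r.
have v_at z : vat v z != 0 -> (dist y z == D - 2)%N = ~~ (dist y z == D).
  move=> vz; have xz : dist x z = 2%N by apply/eqP; apply: contraNT vz => /v_supp ->.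
  have := odd_dist y x z; have := dist_triangle y z x.
  have := dist_diameter y z; rewrite (dist_sym z x) (dist_sym y x) xy xz; lia.
have S0 : vat (A (D - 2) *m v) y + vat (A D *m v) y = 0.
  rewrite -v_sum !vat_distmx -big_split; apply: eq_bigr => z _ /=.
  have [->|/v_at ->] := eqVneq (vat v z) 0; first by rewrite !mulr0 addr0.
  by case: (_ == D); rewrite mul0r mul1r ?addr0 ?add0r.
have : a (D - 2)%N * vat (A (D - 2) *m v) y + a D * vat (A D *m v) y = 0.
  rewrite -(vat0 y) -Fv eigmx_mulv vat_sum.
  have iD : (D - 2 < D.+1)%N by lia.
  rewrite (bigD1 (Ordinal iD)) //= (bigD1 ord_max) /=; last by rewrite -val_eqE /=; lia.
  rewrite big1 ?addr0 ?vatZ // => j; rewrite -!val_eqE /= => /andP[j1 j2].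
  rewrite vatZ vat_distmx big1 ?mulr0 // => z _.
  have [->|/v_at vz] := eqVneq (vat v z) 0; first by rewrite mulr0.
  case: eqP => [yz|]; last by rewrite mul0r.
  by move: vz; rewrite yz (negPf j1) (negPf j2).
have D2 : D = (D - 2).+2 by lia.
have o2 : ~~ odd (D - 2) by lia.
have := eigseq0_neq o2 (_ : (_ < D)%N) aP; rewrite -D2 => /(_ ltac:(lia)) aD.
move: S0 => /eqP; rewrite addrC addr_eq0 => /eqP ->; rewrite mulrN -mulrBl => /eqP.
by rewrite mulf_eq0 subr_eq0 (negPf aD) => /eqP->; rewrite mulr0.
Qed.

(** Take y at distance i + 3 from x and z in the support of [v]. A neighbour w of y with dist z w =
    i is automatically at distance i + 2 from x, and such w exist only if dist y z = i + 1, when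
    there are c_{i+1} of them. *)
Lemma raise_dual i :
  dual_idem C e x i.+3 *m (A 1 *m (dual_idem C e x i.+2 *m A i *m v))
    = (p i.+1 1 i)%N%:R *: (dual_idem C e x i.+3 *m A i.+1 *m v).
Proof.
apply: vatP => y; rewrite -!mulmxA vatZ !vat_dual mulrCA.
have [xy|_] := eqVneq (dist x y) i.+3; last by rewrite !mul0r.
rewrite !mul1r !vat_distmx mulr_sumr.
under eq_bigr do rewrite vat_dual vat_distmx !mulr_sumr.
rewrite exchange_big; apply: eq_bigr => z _ /=.
have [xz|/v_supp ->] := eqVneq (dist x z) 2%N; last by rewrite !mulr0 big1 // => w _; rewrite !mulr0.
have zy := dist_triangle x z y; rewrite xz xy in zy.
rewrite mulrA; under eq_bigr do rewrite !mulrA -!natrM !mulnb.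
rewrite -mulr_suml; congr (_ * _); rewrite -natr_sum -natrM; congr _%:R.
have [yz|yz] := eqVneq (dist y z) i.+1.
  rewrite muln1 -[in RHS]yz -e_dr -sum1_card [RHS]big_mkcond; apply: eq_bigr => w _ /=.
  have := dist_triangle x w y; have := dist_triangle x z w.
  rewrite inE xz xy (dist_sym w y) (dist_sym z w); case: ifP; lia.
rewrite muln0; apply: big1 => w _; have := dist_triangle y w z.
by move: zy yz; rewrite (dist_sym z y); lia.
Qed.

End Endpoint2.

(** * Thin modules of endpoint two *)

Section ThinModule.
Variables (x : X) (W : {vspace 'cV[C]_#|X|}) (v : 'cV[C]_#|X|) (eta : C).
Local Notation E := (dual_idem C e x).
Hypotheses (W_mod : T_module e x W) (W_thin : thin e x W) (W_end : endpoint e x W = 2%N).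
Hypotheses (W_eta : local_eigenvalue e x W eta).
Hypotheses (v_W : v \in dual_part e x W 2) (v_neq0 : v != 0).
Hypothesis D4 : (4 <= D)%N.

Lemma dual_idem_mul i j u : E i *m (E j *m u) = (i == j)%:R *: (E j *m u).
Proof.
apply: vatP => y; rewrite vatZ !vat_dual; have [<-|ij] := eqVneq i j.
  by case: eqP; rewrite ?mul1r ?mul0r.
by case: eqP => [->|]; rewrite ?(negPf ij) ?mul0r ?mulr0.
Qed.

Lemma dual_partP i (w : 'cV_#|X|) : reflect (exists2 u, u \in W & w = E i *m u) (w \in dual_part e x W i).
Proof.
by apply: (iffP memv_imgP) => -[u uW ->]; exists u; rewrite ?lfunE.
Qed.

Lemma dual_part_sub i (w : 'cV_#|X|) : (i <= D)%N -> w \in dual_part e x W i -> w \in W.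
Proof. by move=> iD /dual_partP[u uW ->]; apply: W_mod => //; apply: in_T_dual. Qed.

Lemma dual_part_fix i (w : 'cV_#|X|) : w \in dual_part e x W i -> E i *m w = w.
Proof. by case/dual_partP => u _ ->; rewrite dual_idem_mul eqxx scale1r. Qed.

Lemma dual_part_line i u (w : 'cV_#|X|) : (i <= D)%N -> u \in dual_part e x W i -> u != 0 ->
  w \in dual_part e x W i -> exists c, w = c *: u.
Proof.
move=> iD uWi u0 wWi; apply/vlineP.
suff -> : <[u]>%VS = dual_part e x W i by [].
by apply/eqP; rewrite eqEdim dim_vline u0 W_thin // andbT -memvE.
Qed.

Lemma endpoint_dual i u : (i < 2)%N -> u \in W -> E i *m u = 0.
Proof.
move=> i2 uW; have := i2; rewrite -W_end => /(before_find 0%N).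
rewrite nth_iota ?add0n; last by lia.
move=> /negbFE /eqP Wi0; apply/eqP; rewrite -memv0 -Wi0.
by apply/dual_partP; exists u.
Qed.

Let v_mem : v \in W.
Proof. by apply: dual_part_sub v_W; lia. Qed.

Lemma thin_supp y : dist x y != 2%N -> vat v y = 0.
Proof. by rewrite -(dual_part_fix v_W) vat_dual => /negPf ->; rewrite mul0r. Qed.

(** The sum is the entry of A_2 v at x, which vanishes because E*_0 W = 0. *)
Lemma thin_sum : \sum_y vat v y = 0.
Proof.
have := endpoint_dual (isT : (0 < 2)%N) (W_mod (distmx_in_T x 2) v_mem).
move=> /(congr1 (fun u => vat u x)); rewrite vat_dual distxx mul1r vat0 => A2.
apply: etrans A2; rewrite vat_distmx; apply: eq_bigr => y _.
by case: eqP => [_|/eqP/thin_supp ->]; rewrite ?mul1r ?mulr0.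
Qed.

(** The local eigenvalue comes with some eigenvector in E*_2 W; thinness makes [v] a multiple of
    it. *)
Lemma thin_eta : E 2 *m (A 2 *m v) = eta *: v.
Proof.
have D2 : (2 <= D)%N by lia.
have [w [wW w0 wE]] := W_eta; have [c ->] := dual_part_line D2 wW w0 v_W.
rewrite -!scalemxAr scalerA mulrC -scalerA -wE -!mulmxA.
by rewrite (dual_part_fix wW).
Qed.

Definition sphere_vec i := E i.+2 *m A i *m v.

Lemma sphere_vec_dual i : sphere_vec i \in dual_part e x W i.+2.
Proof.
apply/dual_partP; exists (A i *m v); last by rewrite mulmxA.
by apply: W_mod v_mem; apply: distmx_in_T.
Qed.

Lemma sphere_vec0 : sphere_vec 0 = v.
Proof. by rewrite /sphere_vec distmx0 mulmx1 (dual_part_fix v_W). Qed.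

Lemma sphere_vec_raise i :
  E i.+3 *m (A 1 *m sphere_vec i) = (p i.+1 1 i)%N%:R *: sphere_vec i.+1.
Proof. exact: raise_dual thin_supp D4 i. Qed.

(** Neighbours of the sphere of radius i + 1 lie on the two adjacent spheres; parity excludes the
    sphere itself. *)
Lemma distmx1_split i u : E i.+1 *m u = u ->
  A 1 *m u = E i *m (A 1 *m u) + E i.+2 *m (A 1 *m u).
Proof.
move=> uE; apply: vatP => y; rewrite vatD !vat_dual -mulrDl.
have [E1|E1] := boolP [&& dist x y != i & dist x y != i.+2]; last first.
  suff -> : (dist x y == i)%:R + (dist x y == i.+2)%:R = 1 :> C by rewrite mul1r.
  rewrite -natrD -[RHS]mulr1n; congr _%:R; move: E1; by case: eqP => [->|_]; case: eqP; lia.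
rewrite vat_distmx big1 ?mulr0 // => z _; rewrite -uE vat_dual.
have [yz|] := eqVneq (dist y z) 1%N; last by rewrite mul0r.
have [xz|] := eqVneq (dist x z) i.+1; last by rewrite mul0r mulr0.
have := odd_dist x y z; have := dist_triangle x y z; have := dist_triangle x z y.
by rewrite (dist_sym z y) yz xz; lia.
Qed.

(** For i = 0 the vector lies in E*_1 W = 0. Otherwise thinness makes it a multiple of
    [sphere_vec i.-1], unless that vector is 0, and then the raising relation gives
    [sphere_vec i = 0] as well. The second alternative covers empty spheres. *)
Lemma sphere_vec_lower i :
  E i.+1 *m (A 1 *m sphere_vec i) \in <<[seq sphere_vec j | j <- iota 0 i]>>%VS
  \/ (D < i.+2)%N.
Proof.
case: (leqP i.+2 D) => [iD|]; [left|by right].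
have AW : A 1 *m sphere_vec i \in W.
  by apply: W_mod; [apply: distmx_in_T|apply: dual_part_sub (sphere_vec_dual i)].
case: i iD AW => [|i] iD AW.
  by rewrite endpoint_dual // mem0v.
have [w0|w0] := eqVneq (sphere_vec i) 0.
  have := sphere_vec_raise i; rewrite w0 !mulmx0 => /esym/eqP.
  rewrite scaler_eq0 pnatr_eq0 => /orP[|/eqP ->]; last by rewrite !mulmx0 mem0v.
  by have := @intnum_pred_gt0 i; lia.
have EW : E i.+2 *m (A 1 *m sphere_vec i.+1) \in dual_part e x W i.+2.
  by apply/dual_partP; exists (A 1 *m sphere_vec i.+1).
have [c ->] := dual_part_line (ltnW iD) (sphere_vec_dual i) w0 EW.
by rewrite memvZ // memv_span //; apply: map_f; rewrite mem_iota; lia.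
Qed.

(** [A 1] sends [sphere_vec i] to a combination of earlier vectors plus a multiple of the next one,
    and the vanishing of [sphere_vec m] closes the chain. Each dual idempotent fixes or kills every
    [sphere_vec i]. *)
Lemma sphere_span_mod m : (m.+2 <= D.+1)%N -> sphere_vec m = 0 ->
  T_module e x <<[seq sphere_vec i | i <- iota 0 m]>>%VS.
Proof.
move=> mD wm0; set U := (<<_>>)%VS.
have gen B : (forall i, (i < m)%N -> B *m sphere_vec i \in U) ->
    forall u, u \in U -> B *m u \in U.
  move=> BU u uU; have : linfun (mulmx B) u \in (linfun (mulmx B) @: U)%VS by apply: memv_img.
  rewrite lfunE /= limg_span => Bu; apply: subvP Bu => //; apply/span_subvP => w.
  case/mapP => _ /mapP[i + ->] ->; rewrite mem_iota lfunE /= => im.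
  by apply: BU; lia.
have wU i : (i < m)%N -> sphere_vec i \in U.
  by move=> im; apply: memv_span; apply: map_f; rewrite mem_iota; lia.
move=> B w BT; elim: BT w => {B} [|j jD||B B' _ IH _ IH'|a B _ IH|B B' _ IH _ IH'] w wW.
- apply: gen w wW => i im; rewrite (distmx1_split (dual_part_fix (sphere_vec_dual i))).
  apply: rpredD; last first.
    rewrite sphere_vec_raise memvZ //; have [->|im1] := eqVneq i.+1 m.
      by rewrite wm0 mem0v.
    by apply: wU; lia.
  have [low|] := sphere_vec_lower i; last by lia.
  apply: subvP low; apply: sub_span => w' /mapP[j + ->]; rewrite mem_iota => ji.
  by apply: map_f; rewrite mem_iota; lia.
- apply: gen w wW => i im; rewrite -(dual_part_fix (sphere_vec_dual i)) dual_idem_mul.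
  by rewrite memvZ // (dual_part_fix (sphere_vec_dual i)) wU.
- by rewrite mul1mx.
- by rewrite mulmxDl rpredD ?IH ?IH'.
- by rewrite -scalemxAl memvZ ?IH.
by rewrite -mulmxA IH ?IH'.
Qed.

Hypothesis eta_b3 : eta = (p 3 1 4)%N%:R - 1.

(** The value of [eta] matches the weights in [herm_eigmx] with those in [eigseq_quadratic]. *)
Lemma thin_herm th a : eigseq th a ->
  (k * p 1 1 2 * p 2 1 3)%N%:R * herm v (eigmx a *m v)
    = th ^+ 2 * (k%:R ^+ 2 - th ^+ 2) * herm v v.
Proof.
move=> aP; rewrite -(eigseq_quadratic D4 aP) !natrM.
rewrite (herm_eigmx thin_supp thin_sum thin_eta D4); last by case: aP.
by rewrite eta_b3; ring.
Qed.

Lemma sphere_vec_top : ~~ odd D -> eigenvalue (A 1) 0 -> sphere_vec (D - 2) = 0.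
Proof.
move=> oD /exists_eigseq[a aP]; rewrite /sphere_vec (_ : (D - 2).+2 = D); last by lia.
apply: (eigmx_top thin_supp thin_sum D4 oD aP); apply: (eigmx_isotropic aP).
have := thin_herm aP; rewrite expr0n !mul0r => /eqP; rewrite mulf_eq0 pnatr_eq0 !muln_eq0.
have k0 : k != 0%N by rewrite -intnum_valency -lt0n intnum_succ_gt0 //; lia.
have b1 : (0 < p 1 1 2)%N by apply: intnum_succ_gt0; lia.
have b2 : (0 < p 2 1 3)%N by apply: intnum_succ_gt0; lia.
by rewrite (gtn_eqF b1) (gtn_eqF b2) (negPf k0) => /eqP.
Qed.

(** The eigenvector is [eigmx a *m v]. Were it 0, [thin_herm] would give th^2 (k^2 - th^2) <v, v> =
    0, against [v != 0] and the three excluded values. *)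
Lemma thin_eigvec th : eigenvalue (A 1) th -> th \notin [:: 0; k%:R; - k%:R] ->
  exists u, [/\ u \in W, u != 0 & A 1 *m u = th *: u].
Proof.
move=> /exists_eigseq[a aP]; rewrite !inE !negb_or => /and3P[th0 thk thNk].
exists (eigmx a *m v); split; last by rewrite mulmxA (eigmxP aP) -scalemxAl.
  rewrite eigmx_mulv memv_suml // => j _; rewrite memvZ //.
  by apply: W_mod v_mem; apply: distmx_in_T.
apply: contraNneq v_neq0 => Fv0; apply/eqP/herm_eq0.
have := thin_herm aP; rewrite Fv0.
rewrite (_ : herm v 0 = 0); last by apply: big1 => y _; rewrite vat0 mulr0.
rewrite mulr0 => /esym/eqP; rewrite mulf_eq0 mulf_eq0 (expf_eq0 th 2) (negPf th0) subr_sqr mulf_eq0.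
rewrite subr_eq0 (eq_sym _ th) (negPf thk) addrC addr_eq0 (negPf thNk) /= => /eqP.
exact.
Qed.

End ThinModule.

End BipartiteDistanceRegular.

Theorem theorem14p4 (R : realType) (X : finType) (e : rel X)
    (p : nat -> nat -> nat -> nat) (D k d : nat) (theta : nat -> R[i])
    (x : X) (W : {vspace 'cV[R[i]]_#|X|}) (v : 'cV[R[i]]_#|X|) :
  simple_graph e -> connected_graph e -> bipartite e ->
  distance_regular e p ->
  diameter e = D -> ~~ odd D -> (4 <= D)%N ->
  regular_of_valency e k -> (3 <= k)%N ->
  d = D./2 ->
  ordered_eigenvalues (distmx R[i] e 1) D theta ->
  T_irreducible e x W -> thin e x W -> endpoint e x W = 2%N ->
  local_eigenvalue e x W (theta_tilde p (theta d)) ->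
  v \in dual_part e x W 2 -> v != 0 ->
  basis_of W [seq dual_idem R[i] e x i.+2 *m distmx R[i] e i *m v
             | i <- iota 0 (D - 2)].
Proof.
move=> [e_sym e_irr] e_conn e_bip e_dr eD oD D4 e_reg _ -> th_ord.
move=> [W_mod _ W_irr] W_thin W_end W_eta v_W v_neq0.
subst D; have th0 : theta (diameter e)./2 = 0.
  apply: ordered_eigenvalues_mid th_ord _ oD => a; apply: bipartite_eigenvalueN => //.
  exact: dist_eq1.
have [_ thP] := th_ord.
(* With theta_d = 0 the fraction is b_2 b_3 / (-b_2), and b_2 > 0 cancels. *)
have eta_b3 : theta_tilde p (theta (diameter e)./2) = (p 3 1 4)%N%:R - 1.
  rewrite /theta_tilde th0 expr0n sub0r invrN mulrN opprK /b_ mulrAC mulfV ?mul1r 1?addrC //.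
  by rewrite pnatr_eq0 -lt0n (intnum_succ_gt0 e_sym e_irr e_conn x e_dr); lia.
have top : sphere_vec e x v (diameter e - 2) = 0.
  apply: (sphere_vec_top e_sym e_irr e_conn x e_bip e_dr e_reg W_mod W_thin W_end W_eta v_W v_neq0) => //.
  by apply/thP; exists (diameter e)./2 => //; lia.
set s := [seq _ | i <- _]; have sE : s = [seq sphere_vec e x v i | i <- iota 0 (diameter e - 2)] by [].
have sW : (<<s>> <= W)%VS.
  apply/span_subvP => w; rewrite sE => /mapP[j]; rewrite mem_iota => jD ->.
  apply: (dual_part_sub W_mod) (sphere_vec_dual e_sym e_irr e_conn x e_bip e_dr W_mod W_end v_W v_neq0 D4 j).
  by lia.
have span_s : <<s>>%VS = W.
  have s_mod : T_module e x <<s>>%VS.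
    rewrite sE; apply: (sphere_span_mod e_sym e_irr e_conn x e_bip e_dr W_mod W_thin W_end v_W v_neq0) => //.
    by lia.
  (* By irreducibility the span is 0 or [W]; it is not 0, as it contains [sphere_vec 0 = v]. *)
  have [s0|//] := W_irr _ s_mod sW.
  case/eqP: v_neq0; apply/eqP; rewrite -memv0 -s0.
  rewrite -(sphere_vec0 e_conn v_W) sE; apply/memv_span/map_f; rewrite mem_iota; lia.
(* A spanning list of D - 2 vectors is a basis as soon as D - 2 is at most the dimension of [W]. *)
rewrite basisEdim span_s subvv size_map size_iota /=.
pose bad : seq R[i] := [:: 0; k%:R; - k%:R]; pose th_s := mkseq theta (diameter e).+1.
have th_uniq : uniq th_s.
  apply: sorted_uniq (ordered_eigenvalues_sorted th_ord); last exact: ltxx.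
  by move=> b a c ba cb; apply: lt_trans cb ba.
(* At most three of the D + 1 distinct eigenvalues are excluded, so at least D - 2 remain; an upper
   bound on the excluded ones suffices for this count. *)
have th_bad : (size (filter (mem bad) th_s) <= 3)%N.
  apply: (@uniq_leq_size _ _ bad); first exact: filter_uniq.
  by move=> t; rewrite mem_filter => /andP[].
apply: (@leq_trans (size (filter (predC (mem bad)) th_s))).
  have := count_predC (mem bad) th_s; rewrite -!size_filter size_mkseq; lia.
apply: (@eigvec_dim _ _ (distmx R[i] e 1)) => [|t]; first exact: filter_uniq.
rewrite mem_filter => /andP[tb /mapP[m]]; rewrite mem_iota => mD tE.
apply: (thin_eigvec e_sym e_irr e_conn x e_bip e_dr e_reg W_mod W_thin W_end W_eta v_W v_neq0) => //.
by apply/thP; exists m => //; lia.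
Qed.
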